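(* Let $K\ge 1$. For $\mathbb Q^K$ finite elements the identity $D_x^x = D^x M_x^{-1} D_x$ is never true, and consequently the stabilization terms of standard SUPG do not vanish whenever the Galerkin approximation of the divergence vanishes: there exist grid functions $u,v$ with $$\mathrm{DIV}\,\mathbf v := (D_x\otimes M_y)u+(M_x\otimes D_y)v=0$$ for which the SUPG velocity stabilization terms $$s^u=\alpha h\big[(D_x^x\otimes M_y)u+(D^x\otimes D_y)v\big],\qquad s^v=\alpha h\big[(D_x\otimes D^y)u+(M_x\otimes D^y_y)v\big]$$ are not both zero.
   Context: Setting: an unbounded uniform Cartesian grid, with 1D cells $E^x_i=[x_i,x_{i+1}]$, $x_{i+1}-x_i=\Delta x>0$, $i\in\mathbb Z$, and $E^y_j=[y_j,y_{j+1}]$ of length $\Delta y>0$, $j\in\mathbb Z$. Let $0=\xi_0<\dots<\xi_K=1$ be the $K+1$ Gauss–Lobatto points of $[0,1]$, and $x_{i,p}=x_i+\xi_p\Delta x$ (so $x_{i,K}=x_{i+1,0}$); the distinct nodes are numbered $x_\alpha$, $\alpha=iK+p$ with $0\le p\le K-1$, $\alpha\in\mathbb Z$. Let $\varphi^x_\alpha$ be the continuous function that is a polynomial of degree $\le K$ on each cell and satisfies $\varphi^x_\alpha(x_\beta)=\delta_{\alpha\beta}$. Define the (banded) matrices $$(M_x)_{\alpha\beta}=\int\varphi^x_\alpha\varphi^x_\beta\,dx,\quad (D_x)_{\alpha\beta}=\int\varphi^x_\alpha\,\partial_x\varphi^x_\beta\,dx,\quad (D^x)_{\alpha\beta}=\int\partial_x\varphi^x_\alpha\,\varphi^x_\beta\,dx,\quad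 (D^x_x)_{\alpha\beta}=\int\partial_x\varphi^x_\alpha\,\partial_x\varphi^x_\beta\,dx,$$ where all integrals are evaluated cellwise with the Gauss–Lobatto quadrature at the nodes (so $M_x$ is diagonal with positive entries; the other integrals are exact). $M_y,D_y,D^y,D^y_y$ are defined analogously in $y$. A grid function is a real array $(q_{\alpha;\beta})_{\alpha,\beta\in\mathbb Z}$, and $((A\otimes B)q)_{\alpha;\beta}=\sum_{\alpha',\beta'}A_{\alpha\alpha'}B_{\beta\beta'}q_{\alpha';\beta'}$. Here $\alpha>0$ in $\alpha h$ denotes the constant stabilization parameter and $h=\min\{\Delta x,\Delta y\}$. *)

(* Defs.v *)
From HB Require Import structures.
From mathcomp Require Import all_boot all_order all_algebra.
From mathcomp Require Import all_classical all_reals all_analysis.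

Set Implicit Arguments.
Unset Strict Implicit.
Unset Printing Implicit Defensive.

Import Order.TTheory GRing.Theory Num.Theory.
Import numFieldNormedType.Exports.

Local Open Scope classical_set_scope.
Local Open Scope ring_scope.

(* Rodrigues' formula transported to [0, 1]: this polynomial is P_K(2X - 1),
   with P_K the usual Legendre polynomial on [-1, 1]; note that p^`N(K) already
   contains the factor 1 / K!. *)
Definition shifted_legendre (R : realType) (K : nat) : {poly R} :=
  (('X ^+ 2 - 'X) ^+ K)^`N(K).

(* The K+1 Gauss-Lobatto points of [0, 1]: the two endpoints and, in between,
   the zeros of the derivative of the Legendre polynomial of degree K. *)
Definition gauss_lobatto_points (R : realType) (K : nat)
    (xi : 'I_K.+1 -> R) : Prop :=
  [/\ xi ord0 = 0, xi ord_max = 1,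
      forall p q : 'I_K.+1, (p < q)%N -> xi p < xi q
    & forall p : 'I_K.+1, (0 < p < K)%N ->
        root (shifted_legendre R K)^`() (xi p)].

Definition lagrange_poly (R : realType) (K : nat) (xi : 'I_K.+1 -> R)
    (p : 'I_K.+1) : {poly R} :=
  \prod_(q < K.+1 | q != p) ((xi p - xi q)^-1 *: ('X - (xi q)%:P)).

Definition quad_weight (R : realType) (K : nat) (xi : 'I_K.+1 -> R)
    (p : 'I_K.+1) : R :=
  Rintegral (@lebesgue_measure R) `[0, 1]%classic
    (fun t => (lagrange_poly xi p).[t]).

(* A uniform grid of the line, with cells [vertex i, vertex (i + 1)], together
   with the nodal basis phi of the continuous piecewise Q^K elements on it.
   [phi_cell a i] is the polynomial that phi a coincides with on cell i; it is
   needed because phi a has no derivative at the vertices, so that the cellwise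
   quadratures below must evaluate derivatives from inside the cell.
   The global number of the node vertex i + xi p * step (p < K) is i * K + p. *)
Record fe_space (R : realType) (K : nat) (xi : 'I_K.+1 -> R) := FeSpace {
  vertex : int -> R;
  step : R;
  phi : int -> R -> R;
  phi_cell : int -> int -> {poly R};
  step_gt0 : 0 < step;
  vertex_step : forall i, vertex (i + 1) - vertex i = step;
  phi_continuous : forall a, continuous (phi a);
  size_phi_cell : forall a i, (size (phi_cell a i) <= K.+1)%N;
  phi_cellE : forall a i t, vertex i <= t <= vertex (i + 1) ->
    phi a t = (phi_cell a i).[t];
  phi_node : forall a i (p : 'I_K.+1), (p < K)%N ->
    phi a (vertex i + xi p * step) = (a == i * K%:Z + p%:Z)%:R
}.

(* Cellwise quadrature over the whole line of a function given on each cell i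
   by the polynomial f i. Here and below, \sum_(_ \in _) is the sum of a
   finitely supported family. *)
Definition quadrature (R : realType) (K : nat) (xi : 'I_K.+1 -> R)
    (X : fe_space xi) (f : int -> {poly R}) : R :=
  \sum_(i \in [set: int])
    \sum_(p < K.+1)
      step X * quad_weight xi p * (f i).[vertex X i + xi p * step X].

Definition zmatrix (R : realType) := int -> int -> R.
Definition grid_function (R : realType) := int -> int -> R.

Section Matrices.
Context (R : realType) (K : nat) (xi : 'I_K.+1 -> R) (X : fe_space xi).

(* M_x *)
Definition mass : zmatrix R := fun a b =>
  quadrature X (fun i => phi_cell X a i * phi_cell X b i).

(* D_x, derivative on the second (column) function *)
Definition dlow : zmatrix R := fun a b =>
  quadrature X (fun i => phi_cell X a i * (phi_cell X b i)^`()).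

(* D^x, derivative on the first (row) function *)
Definition dup : zmatrix R := fun a b =>
  quadrature X (fun i => (phi_cell X a i)^`() * phi_cell X b i).

(* D^x_x *)
Definition duplow : zmatrix R := fun a b =>
  quadrature X (fun i => (phi_cell X a i)^`() * (phi_cell X b i)^`()).

(* M_x^-1; the Gauss-Lobatto mass matrix is diagonal with positive entries *)
Definition mass_inv : zmatrix R := fun a b =>
  if a == b then (mass a a)^-1 else 0.

End Matrices.

Definition zmatrix_mul (R : realType) (A B : zmatrix R) : zmatrix R :=
  fun a b => \sum_(c \in [set: int]) A a c * B c b.

Definition tensor_apply (R : realType) (A B : zmatrix R)
    (q : grid_function R) : grid_function R :=
  fun a b => \sum_(c \in [set: int * int]) A a c.1 * B b c.2 * q c.1 c.2.

Section Supg.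
Context (R : realType) (K : nat) (xi : 'I_K.+1 -> R) (X Y : fe_space xi).

Definition DIV (u v : grid_function R) : grid_function R := fun a b =>
  tensor_apply (dlow X) (mass Y) u a b + tensor_apply (mass X) (dlow Y) v a b.

Definition supg_u (alpha : R) (u v : grid_function R) : grid_function R :=
  fun a b => alpha * Num.min (step X) (step Y) *
    (tensor_apply (duplow X) (mass Y) u a b
     + tensor_apply (dup X) (dlow Y) v a b).

Definition supg_v (alpha : R) (u v : grid_function R) : grid_function R :=
  fun a b => alpha * Num.min (step X) (step Y) *
    (tensor_apply (dlow X) (dup Y) u a b
     + tensor_apply (mass X) (duplow Y) v a b).

End Supg.

(* Main.v *)
Require Import Defs.
From mathcomp Require Import all_boot all_order all_algebra.
From mathcomp Require Import all_classical all_reals all_analysis.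
From mathcomp Require Import ring zify.

Set Implicit Arguments.
Unset Strict Implicit.
Unset Printing Implicit Defensive.

Import Order.TTheory GRing.Theory Num.Theory.
Import numFieldNormedType.Exports.

Local Open Scope ring_scope.

(** Let Z = D^x_x - D^x M_x^-1 D_x.  Applying M_x^-1 D_x to a piecewise
    polynomial differentiates it at the nodes inside the cells and averages
    the two one-sided derivatives at the vertices, whereas D^x_x uses those
    one-sided derivatives themselves.  Hence Z only sees the derivative jumps,
    and Z_(a,b) is a sum over the vertices of a multiple of the product of the
    jumps of phi_a' and phi_b'.  The entry (-K, K), between the vertices -1
    and 1, isolates one term of that sum: phi_(-K) and phi_K share no cell, so
    the stiffness entry vanishes ([duplow_far]), and vertex 0 is the only node
    in the cells of both, so the product D^x M_x^-1 D_x reduces to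
    (D^x)_(-K,0) (M_x)_(0,0)^-1 (D_x)_(0,K) ([zmatrix_mul_far]).

    The factors are nonzero for two reasons.  A nodal basis polynomial of a
    cell has only simple zeros, so its derivative does not vanish at a vertex
    other than its own node ([deriv_node_neq0]).  And the two extreme
    quadrature weights are equal and nonzero ([quad_weight_ends]): if L is
    the shifted Legendre polynomial of degree K, then (X - 1) L' and X L' are
    multiples of the two extreme Lagrange polynomials, and integrating them by
    parts gives (-1)^K and 1, because L has mean zero on [0, 1].

    For the second assertion, any grid function psi gives a pair
    u = (I (x) M_y^-1 D_y) psi, v = - (M_x^-1 D_x (x) I) psi whose discrete
    divergence vanishes, the two terms being +- (D_x (x) D_y) psi.  For this
    pair s^u is alpha h (Z (x) D_y) psi; taking psi concentrated at the node
    (K, K), its value at (-K, 0) is alpha h Z_(-K,K) (D_y)_(0,K), which is not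
    zero. *)

(** * Shifted Legendre polynomials *)

Lemma Rintegral_deriv01 (R : realType) (P : {poly R}) :
  Rintegral (@lebesgue_measure R) `[0, 1]%classic (fun t => (P^`()).[t])
  = P.[1] - P.[0].
Proof.
rewrite /Rintegral.
rewrite (@continuous_FTC2 R (horner P^`()) (horner P) 0 1) ?ltr01 //.
- by apply: continuous_subspaceT => x; apply: continuous_horner.
- split; first by move=> x _; exact: derivable_horner.
  + by apply: cvg_at_right_filter; exact: continuous_horner.
  + by apply: cvg_at_left_filter; exact: continuous_horner.
- by move=> x _; rewrite derivE.
Qed.

Lemma derivn_comp_reflect (R : comNzRingType) (P : {poly R}) n :
  (P \Po (1 - 'X))^`(n) = (-1) ^+ n *: (P^`(n) \Po (1 - 'X)).
Proof.
elim: n => [|n IHn]; first by rewrite !derivn0 expr0 scale1r.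
rewrite !derivnS IHn derivZ deriv_comp derivB derivX derivC sub0r.
by rewrite mulrN1 exprS mulN1r scaleNr scalerN.
Qed.

(** X^2 - X is invariant under the reflection X |-> 1 - X of [0, 1], so each
    derivative of its powers is even or odd under that reflection. *)
Lemma nderivn_bubble_reflect (R : numFieldType) (K n : nat) :
  ((('X ^+ 2 - 'X) ^+ K)^`N(n) : {poly R}) \Po (1 - 'X)
  = (-1) ^+ n *: (('X ^+ 2 - 'X) ^+ K)^`N(n).
Proof.
set Q : {poly R} := (_ - _) ^+ K.
have QE : Q \Po (1 - 'X) = Q.
  rewrite /Q !rmorphXn /= comp_polyB rmorphXn /= comp_polyX; congr (_ ^+ K).
  by ring.
have n0 : (n`!%:R : R) != 0 by rewrite pnatr_eq0 -lt0n fact_gt0.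
apply: (scalerI n0); rewrite scalerA mulrC -scalerA -comp_polyZ !scaler_nat.
rewrite -nderivn_def -[in RHS]QE derivn_comp_reflect scalerA -exprD addnn.
by rewrite -signr_odd odd_double expr0 scale1r.
Qed.

(** 0 is a zero of order K of (X^2 - X)^K. *)
Lemma nderivn_bubble0 (R : numFieldType) (K n : nat) : (n < K)%N ->
  ((('X ^+ 2 - 'X) ^+ K)^`N(n) : {poly R}).[0] = 0.
Proof.
move=> nK; rewrite horner_coef0 coef_nderivn addn0.
have -> : ('X ^+ 2 - 'X : {poly R}) = 'X * ('X - 1) by ring.
by rewrite exprMn coefXnM nK mul0rn.
Qed.

Lemma nderivn_bubble_horner1 (R : numFieldType) (K n : nat) :
  ((('X ^+ 2 - 'X) ^+ K)^`N(n) : {poly R}).[1]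
  = (-1) ^+ n * ((('X ^+ 2 - 'X) ^+ K)^`N(n) : {poly R}).[0].
Proof.
by rewrite -hornerZ -nderivn_bubble_reflect horner_comp !hornerE subr0.
Qed.

Lemma shifted_legendre_horner0 (R : realType) (K : nat) :
  (shifted_legendre R K).[0] = (-1) ^+ K.
Proof.
rewrite horner_coef0 coef_nderivn addn0 binn mulr1n.
have -> : ('X ^+ 2 - 'X : {poly R}) = 'X * ('X - 1) by ring.
by rewrite exprMn coefXnM ltnn subnn -horner_coef0 !hornerE.
Qed.

Lemma shifted_legendre_horner1 (R : realType) (K : nat) :
  (shifted_legendre R K).[1] = 1.
Proof.
rewrite /shifted_legendre nderivn_bubble_horner1.
by rewrite -/(shifted_legendre R K) shifted_legendre_horner0 -expr2 sqrr_sign.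
Qed.

Lemma shifted_legendre_deriv1 (R : realType) (K : nat) :
  (shifted_legendre R K)^`().[1] = - (-1) ^+ K * (shifted_legendre R K)^`().[0].
Proof.
have := congr1 (fun P => P^`().[0]) (nderivn_bubble_reflect R K K).
rewrite deriv_comp derivB derivX derivC sub0r derivZ hornerM horner_comp.
rewrite hornerZ !hornerE subr0 => E.
by rewrite -/(shifted_legendre R K) in E; rewrite mulNr -E; ring.
Qed.

(** The shifted Legendre polynomial has mean zero: by Rodrigues' formula, a
    multiple of the previous derivative of (X^2 - X)^K is a primitive of it
    that vanishes at both ends. *)
Lemma shifted_legendre_primitive (R : realType) (K : nat) :
  (0 < K)%N -> exists2 S : {poly R},
    S^`() = shifted_legendre R K & S.[0] = 0 /\ S.[1] = 0.
Proof.
case: K => // K _; set Q : {poly R} := ('X ^+ 2 - 'X) ^+ K.+1.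
exists (K.+1%:R^-1 *: Q^`N(K)); last first.
  by rewrite !hornerZ nderivn_bubble_horner1 nderivn_bubble0 // !mulr0.
have n0 : (K.+1`!%:R : R) != 0 by rewrite pnatr_eq0 -lt0n fact_gt0.
apply: (scalerI n0); rewrite derivZ scalerA factS natrM mulrAC.
rewrite mulfV ?pnatr_eq0 // mul1r -derivZ scaler_nat -nderivn_def.
by rewrite -natrM -factS scaler_nat /shifted_legendre -nderivn_def derivnS.
Qed.

(** * Extreme weights of the Gauss-Lobatto quadrature *)

Lemma poly_eq0_nodes (R : idomainType) (n : nat) (z : 'I_n -> R) (P : {poly R}) :
  injective z -> (size P <= n)%N -> (forall p, P.[z p] = 0) -> P = 0.
Proof.
move=> zI sP P0; apply: (@roots_geq_poly_eq0 _ _ (codom z)).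
- by apply/allP => _ /codomP[p ->]; apply/rootP.
- by rewrite map_inj_uniq // enum_uniq.
- by rewrite size_codom card_ord.
Qed.

Lemma gauss_lobatto_inj (R : realType) (K : nat) (xi : 'I_K.+1 -> R) :
  gauss_lobatto_points xi -> injective xi.
Proof.
move=> [_ _ xi_lt _] p q /eqP E; apply/eqP; rewrite -val_eqE /=.
case: (ltngtP p q) E => // /xi_lt; first by move/lt_eqF ->.
by move/gt_eqF ->.
Qed.

Lemma lagrange_node (R : realType) (K : nat) (xi : 'I_K.+1 -> R) p q :
  injective xi -> (lagrange_poly xi p).[xi q] = (q == p)%:R.
Proof.
move=> xiI; rewrite horner_prod; case: eqVneq => [->|qp].
  apply: big1 => r rp; rewrite !hornerE mulVf // subr_eq0.
  by rewrite (inj_eq xiI) eq_sym.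
by rewrite (bigD1 q) //= !hornerE subrr mulr0 mul0r.
Qed.

Lemma size_lagrange (R : realType) (K : nat) (xi : 'I_K.+1 -> R) p :
  (size (lagrange_poly xi p) <= K.+1)%N.
Proof.
apply: leq_trans (size_prod_leq _ _) _.
have card_p : #|[pred q : 'I_K.+1 | q != p]| = K by rewrite cardC1 card_ord.
rewrite card_p leq_subLR addnS ltnS.
have -> : (K + K = \sum_(q < K.+1 | q != p) 2)%N.
  by rewrite sum_nat_const card_p muln2 addnn.
apply: leq_sum => q _; apply: leq_trans (size_scale_leq _ _) _.
by rewrite size_XsubC.
Qed.

Lemma lagrange_interpolation (R : realType) (K : nat) (xi : 'I_K.+1 -> R) p
    (P : {poly R}) : injective xi -> (size P <= K.+1)%N ->
  (forall q, q != p -> P.[xi q] = 0) -> P = P.[xi p] *: lagrange_poly xi p.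
Proof.
move=> xiI sP P0; apply/eqP; rewrite -subr_eq0; apply/eqP.
apply: (@poly_eq0_nodes _ _ xi) => // [|q].
  rewrite (leq_trans (size_polyD _ _)) // size_polyN geq_max sP /=.
  by rewrite (leq_trans (size_scale_leq _ _)) // size_lagrange.
rewrite !hornerE lagrange_node //; case: eqVneq => [->|/P0 ->].
  by rewrite mulr1 subrr.
by rewrite mulr0 subrr.
Qed.

Lemma poly_primitive (R : numFieldType) (P : {poly R}) :
  exists S : {poly R}, P = S^`().
Proof.
exists (\poly_(i < (size P).+1) (P`_i.-1 / i%:R)).
apply/polyP => i; rewrite coef_deriv coef_poly ltnS /=.
case: ltnP => si; last by rewrite nth_default // mul0rn.
by rewrite -[RHS]mulr_natr mulfVK // pnatr_eq0.
Qed.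

(** A polynomial of degree at most K that vanishes at all nodes but one is a
    multiple of a Lagrange polynomial; giving it as a derivative makes its
    integral explicit, hence yields the weight of the remaining node. *)
Lemma quad_weight_deriv (R : realType) (K : nat) (xi : 'I_K.+1 -> R) p
    (P : {poly R}) : injective xi -> (size P^`() <= K.+1)%N ->
  (forall q, q != p -> P^`().[xi q] = 0) ->
  P^`().[xi p] * quad_weight xi p = P.[1] - P.[0].
Proof.
move=> xiI sP P0; rewrite -(Rintegral_deriv01 P) /quad_weight.
rewrite [P^`() in RHS](@lagrange_interpolation _ _ xi p) //.
have [S ->] := poly_primitive (lagrange_poly xi p).
by rewrite -derivZ !Rintegral_deriv01 !hornerZ mulrBr.
Qed.

Lemma size_shifted_legendre (R : realType) (K : nat) :
  (size (shifted_legendre R K) <= K.+1)%N.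
Proof.
apply: leq_trans (size_poly _ _) _; rewrite leq_subLR addnS.
apply: leq_trans (size_poly_exp_leq _ _) _; rewrite ltnS addnn -mul2n.
have : (size ('X ^+ 2 - 'X : {poly R})%R <= 3)%N.
  by rewrite (leq_trans (size_polyD _ _)) // size_polyN size_polyXn size_polyX.
by move=> s3; apply: leq_mul => //; rewrite -subn1 leq_subLR.
Qed.

Lemma size_shifted_legendre_deriv (R : realType) (K : nat) :
  (size (shifted_legendre R K)^`() <= K)%N.
Proof.
apply: leq_trans (size_poly _ _) _.
by rewrite -subn1 leq_subLR add1n size_shifted_legendre.
Qed.

Lemma size_XsubC_legendre (R : realType) (K : nat) (e : R) :
  (size (('X - e%:P) * (shifted_legendre R K)^`())%R <= K.+1)%N.
Proof.
by rewrite (leq_trans (size_polyMleq _ _)) // size_XsubC ltnS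
  size_shifted_legendre_deriv.
Qed.

(** Here e is the end of [0, 1] opposite to the node p.  The polynomial
    (X - e) L' vanishes at all nodes but p, and it is the derivative of
    (X - e) L - S, where S is the primitive of L that vanishes at 0 and 1. *)
Lemma quad_weight_endpoint (R : realType) (K : nat) (xi : 'I_K.+1 -> R)
    (p : 'I_K.+1) (e : R) : (0 < K)%N -> gauss_lobatto_points xi ->
  (forall q, q != p -> xi q = e \/ (0 < q < K)%N) ->
  (xi p - e) * (shifted_legendre R K)^`().[xi p] * quad_weight xi p
  = (1 - e) + e * (-1) ^+ K.
Proof.
move=> K0 hxi nodes; have [_ _ _ xiroot] := hxi.
have [S dS [S0 S1]] := shifted_legendre_primitive R K0.
pose P := ('X - e%:P) * shifted_legendre R K - S.
have dP : P^`() = ('X - e%:P) * (shifted_legendre R K)^`().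
  by rewrite derivB derivM derivB derivX derivC dS; ring.
have := @quad_weight_deriv R K xi p P (gauss_lobatto_inj hxi).
rewrite dP hornerM hornerXsubC => -> //.
- rewrite !hornerE S0 S1 shifted_legendre_horner0 shifted_legendre_horner1.
  by ring.
- exact: size_XsubC_legendre.
- move=> q /nodes[xiq|/xiroot /rootP r0]; rewrite hornerM ?r0 ?mulr0 //.
  by rewrite hornerXsubC xiq subrr mul0r.
Qed.

(** Both weights are known up to the factors L'(0) and L'(1), which the
    reflection symmetry of L makes equal up to sign.  The equality is what
    later keeps their sum, a diagonal entry of the mass matrix, from
    vanishing. *)
Lemma quad_weight_ends (R : realType) (K : nat) (xi : 'I_K.+1 -> R) :
  (0 < K)%N -> gauss_lobatto_points xi ->
  quad_weight xi ord0 != 0 /\ quad_weight xi ord_max = quad_weight xi ord0.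
Proof.
move=> K0 hxi; have [xi0 xiK _ _] := hxi.
have := @quad_weight_endpoint R K xi ord0 1 K0 hxi.
have := @quad_weight_endpoint R K xi ord_max 0 K0 hxi.
rewrite xi0 xiK shifted_legendre_deriv1 !subr0 !subrr sub0r => wK w0.
set d := _^`().[0] in w0 wK; have s2 : (-1) ^+ K * (-1) ^+ K = 1 :> R.
  by rewrite -expr2 sqrr_sign.
have {}w0 : d * quad_weight xi ord0 = - (-1) ^+ K.
  (* Node 0 is isolated by the factor X - 1. *)
  rewrite -[LHS]opprK -mulNr; congr (- _); rewrite -mulN1r w0; first by ring.
  move=> q q0; have [qK|qK] := eqVneq q ord_max; [left|right].
    by rewrite qK.
  rewrite -!val_eqE /= in q0 qK; have := ltn_ord q; lia.
(* Node 1 is isolated by the factor X, and L'(1) = - (-1)^K L'(0). *)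
have {}wK : d * quad_weight xi ord_max = - (-1) ^+ K.
  transitivity (- (-1) ^+ K * (1 * (- (-1) ^+ K * d) * quad_weight xi ord_max)).
    by rewrite mul1r mulrA mulrA mulrNN s2 mul1r.
  rewrite wK; first by ring.
  move=> q qK; have [q0|q0] := eqVneq q ord0; [left|right].
    by rewrite q0.
  rewrite -!val_eqE /= in q0 qK; have := ltn_ord q; lia.
have sn0 : - (-1) ^+ K != 0 :> R by rewrite oppr_eq0 signr_eq0.
have d0 : d != 0 by apply: contraNneq sn0 => d0; rewrite -w0 d0 mul0r.
split; last by apply: (mulfI d0); rewrite w0 wK.
by apply: contraNneq sn0 => q0; rewrite -w0 q0 mulr0.
Qed.

(** * Nodal basis *)

(** P already has n - 1 distinct zeros and degree below n, so none of them can
    be a double zero. *)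
Lemma deriv_node_neq0 (R : idomainType) (n : nat) (z : 'I_n -> R)
    (P : {poly R}) (p q : 'I_n) : injective z -> (size P <= n)%N ->
  (forall r, r != p -> P.[z r] = 0) -> P != 0 -> q != p -> P^`().[z q] != 0.
Proof.
move=> zI sP P0 Pn0 qp.
have /factor_theorem[G PE] : root P (z q) by apply/rootP/P0.
have G0 : G != 0 by apply: contraNneq Pn0 => G0; rewrite PE G0 mul0r.
rewrite PE derivM derivXsubC mulr1 hornerD hornerM hornerXsubC subrr mulr0 add0r.
(* If P'(z q) = G(z q) = 0, restoring the missing zero z p in place of z q
   gives a polynomial of the same degree that vanishes at all n nodes. *)
apply/eqP => Gq; have /eqP : G * ('X - (z p)%:P) = 0.
  apply: (poly_eq0_nodes zI) => [|r].
    by move: sP; rewrite PE !size_Mmonic ?monicXsubC // !size_XsubC.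
  rewrite hornerM hornerXsubC; have [->|rp] := eqVneq r p.
    by rewrite subrr mulr0.
  have [->|rq] := eqVneq r q; first by rewrite Gq mul0r.
  have /eqP := P0 r rp; rewrite PE hornerM hornerXsubC mulf_eq0 subr_eq0.
  by rewrite (inj_eq zI) (negPf rq) orbF => /eqP ->; rewrite mul0r.
by rewrite mulf_eq0 (negPf G0) polyXsubC_eq0.
Qed.

Definition node (R : realType) (K : nat) (xi : 'I_K.+1 -> R)
  (X : fe_space xi) (i : int) (p : 'I_K.+1) : R := vertex X i + xi p * step X.

Lemma node_inj (R : realType) (K : nat) (xi : 'I_K.+1 -> R) (X : fe_space xi) i :
  gauss_lobatto_points xi -> injective (node X i).
Proof.
move=> /gauss_lobatto_inj xiI p q /addrI /mulIf E.
by apply/xiI/E; rewrite gt_eqF // step_gt0.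
Qed.

(** The field [phi_node] covers the nodes p < K of each cell; the last node of
    cell i is the first node of cell i + 1. *)
Lemma phi_cell_node (R : realType) (K : nat) (xi : 'I_K.+1 -> R)
    (X : fe_space xi) (a i : int) (p : 'I_K.+1) :
  (0 < K)%N -> gauss_lobatto_points xi ->
  (phi_cell X a i).[node X i p] = (a == i * K%:Z + p%:Z)%:R.
Proof.
move=> K0 [xi0 xiK xi_lt _].
have s0 := step_gt0 X; have vS j : vertex X (j + 1) = vertex X j + step X.
  by rewrite -(vertex_step X j) [RHS]addrC subrK.
have le_xi (q r : 'I_K.+1) : (q <= r)%N -> xi q <= xi r.
  rewrite leq_eqVlt => /orP[/eqP/val_inj->|/xi_lt/ltW] //.
rewrite -phi_cellE; last first.
  rewrite /node vS lerDl lerD2l ler_piMl ?(ltW s0) // -?xiK ?le_xi ?leq_ord //.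
  by rewrite mulr_ge0 ?(ltW s0) // -xi0 le_xi.
have [pK|Kp] := ltnP p K; first by rewrite /node phi_node.
have -> : p = ord_max by apply/val_inj/eqP; rewrite eqn_leq Kp leq_ord.
have -> : node X i ord_max = vertex X (i + 1) + xi ord0 * step X.
  by rewrite /node vS xiK xi0 mul1r mul0r addr0.
by rewrite phi_node //= addr0 mulrDl mul1r.
Qed.

Lemma phi_cell_support (R : realType) (K : nat) (xi : 'I_K.+1 -> R)
    (X : fe_space xi) (a i : int) : (0 < K)%N -> gauss_lobatto_points xi ->
  ~~ (i * K%:Z <= a <= i * K%:Z + K%:Z) -> phi_cell X a i = 0.
Proof.
move=> K0 hxi out; apply: (poly_eq0_nodes (@node_inj _ _ _ X i hxi)).
  exact: size_phi_cell.
move=> p; rewrite phi_cell_node //; case: eqP out => // ->.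
by have := leq_ord p; lia.
Qed.

Lemma phi_cell_deriv_neq0 (R : realType) (K : nat) (xi : 'I_K.+1 -> R)
    (X : fe_space xi) (a i : int) (p q : 'I_K.+1) :
  (0 < K)%N -> gauss_lobatto_points xi -> a = i * K%:Z + p%:Z -> q != p ->
  (phi_cell X a i)^`().[node X i q] != 0.
Proof.
move=> K0 hxi aE qp.
apply: (deriv_node_neq0 (@node_inj _ _ _ X i hxi) (size_phi_cell X a i) _ _ qp).
  move=> r rp; rewrite phi_cell_node // aE (inj_eq (addrI _)).
  by rewrite eqz_nat (inj_eq (@ord_inj _)) eq_sym (negPf rp).
apply/eqP => P0; have := phi_cell_node X a i p K0 hxi.
by rewrite P0 horner0 aE eqxx => /esym/eqP; rewrite oner_eq0.
Qed.

(** * Reduction of the sums to finitely many terms *)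

Lemma fsbig_setT_seq (R : nmodType) (T : choiceType) (r : seq T) (F : T -> R) :
  uniq r -> (forall x, x \notin r -> F x = 0) ->
  \sum_(x \in [set: T]) F x = \sum_(x <- r) F x.
Proof.
move=> ur F0; rewrite [RHS]fsbig_seq // (fsbig_widen [set` r]%classic setT) //.
by move=> x [_ /= /negP xr]; exact: F0.
Qed.

Lemma fsbig_setT_single (R : nmodType) (T : choiceType) (x0 : T) (F : T -> R) :
  (forall x, x != x0 -> F x = 0) -> \sum_(x \in [set: T]) F x = F x0.
Proof.
move=> F0; rewrite (@fsbig_setT_seq _ _ [:: x0]) ?big_seq1 // => x.
by rewrite inE; exact: F0.
Qed.

Lemma quadrature_cell_phi (R : realType) (K : nat) (xi : 'I_K.+1 -> R)
    (X : fe_space xi) (a i : int) (p : 'I_K.+1) (g : {poly R}) :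
  (0 < K)%N -> gauss_lobatto_points xi -> a = i * K%:Z + p%:Z ->
  \sum_(q < K.+1) step X * quad_weight xi q *
     (phi_cell X a i * g).[vertex X i + xi q * step X]
  = step X * quad_weight xi p * g.[node X i p].
Proof.
move=> K0 hxi aE; rewrite (bigD1 p) //= big1 ?addr0.
  by rewrite hornerM -/(node X i p) phi_cell_node // aE eqxx mul1r.
move=> q qp; rewrite hornerM -/(node X i q) phi_cell_node // aE.
by rewrite (inj_eq (addrI _)) eqz_nat (inj_eq (@ord_inj _)) eq_sym (negPf qp) mul0r mulr0.
Qed.

(** The factor phi_a collapses the quadrature to the node a: one term if the
    node is inside a cell, and one term from each adjacent cell, with one-sided
    values of g, if it is a vertex. *)
Lemma quadrature_phi_interior (R : realType) (K : nat) (xi : 'I_K.+1 -> R)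
    (X : fe_space xi) (a i : int) (p : 'I_K.+1) (g : int -> {poly R}) :
  (0 < K)%N -> gauss_lobatto_points xi -> a = i * K%:Z + p%:Z ->
  (0 < p < K)%N ->
  quadrature X (fun j => phi_cell X a j * g j)
  = step X * quad_weight xi p * (g i).[node X i p].
Proof.
move=> K0 hxi aE p_int; rewrite -(quadrature_cell_phi X (g i) K0 hxi aE).
apply: fsbig_setT_single => j ji; apply: big1 => q _.
rewrite phi_cell_support // ?mul0r ?horner0 ?mulr0 //.
by rewrite aE; apply/negP; nia.
Qed.

Lemma quadrature_phi_vertex (R : realType) (K : nat) (xi : 'I_K.+1 -> R)
    (X : fe_space xi) (a i : int) (g : int -> {poly R}) :
  (0 < K)%N -> gauss_lobatto_points xi -> a = i * K%:Z ->
  quadrature X (fun j => phi_cell X a j * g j)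
  = step X * quad_weight xi ord_max * (g (i - 1)).[node X (i - 1) ord_max]
    + step X * quad_weight xi ord0 * (g i).[node X i ord0].
Proof.
move=> K0 hxi aE.
rewrite /quadrature (@fsbig_setT_seq _ _ [:: i - 1; i]) /=.
- rewrite big_cons big_seq1 (@quadrature_cell_phi _ _ _ _ _ _ ord_max) //.
    by rewrite (@quadrature_cell_phi _ _ _ _ _ _ ord0) //= aE addr0.
  by rewrite aE mulrBl mul1r subrK.
- by rewrite inE andbT; lia.
- move=> j; rewrite !inE negb_or => /andP[ji1 ji]; apply: big1 => q _.
  rewrite phi_cell_support // ?mul0r ?horner0 ?mulr0 //.
  by rewrite aE; apply/negP; nia.
Qed.

(** * The one-dimensional matrices *)

Lemma mass_offdiag (R : realType) (K : nat) (xi : 'I_K.+1 -> R)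
    (X : fe_space xi) (a b : int) :
  (0 < K)%N -> gauss_lobatto_points xi -> a != b -> mass X a b = 0.
Proof.
move=> K0 hxi ab; apply: fsbig1 => i _; apply: big1 => q _.
rewrite hornerM -/(node X i q) !phi_cell_node //.
case: eqP => [aE|_]; last by rewrite mul0r mulr0.
by rewrite -aE eq_sym (negPf ab) mulr0 mulr0.
Qed.

Lemma mass_vertex_neq0 (R : realType) (K : nat) (xi : 'I_K.+1 -> R)
    (X : fe_space xi) (i : int) : (0 < K)%N -> gauss_lobatto_points xi ->
  mass X (i * K%:Z) (i * K%:Z) != 0.
Proof.
move=> K0 hxi; rewrite /mass.
rewrite (@quadrature_phi_vertex _ _ _ _ _ i) // !phi_cell_node //=.
rewrite addr0 mulrBl mul1r subrK eqxx !mulr1.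
have [w0 ->] := quad_weight_ends K0 hxi.
by rewrite -mulr2n mulrn_eq0 /= mulf_neq0 // gt_eqF // step_gt0.
Qed.

(** At a node where the mass would vanish, so would the whole row of D_x, since
    inside a cell both carry the weight of the node as a factor. *)
Lemma mass_mass_inv_dlow (R : realType) (K : nat) (xi : 'I_K.+1 -> R)
    (X : fe_space xi) (a b : int) : (0 < K)%N -> gauss_lobatto_points xi ->
  mass X a a * mass_inv X a a * dlow X a b = dlow X a b.
Proof.
move=> K0 hxi; rewrite /mass_inv eqxx.
have [m0|m0] := eqVneq (mass X a a) 0; last by rewrite mulfV // mul1r.
rewrite m0 mul0r mul0r; symmetry.
have Kz : K%:Z != 0 by rewrite eqz_nat -lt0n.
have r_lt : (`|(a %% K%:Z)%Z| < K)%N.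
  by have := ltz_mod a Kz; have := modz_ge0 a Kz; lia.
pose p : 'I_K.+1 := inord `|(a %% K%:Z)%Z|.
have pE : p = `|(a %% K%:Z)%Z|%N :> nat by rewrite inordK // ltnW.
have aE : a = (a %/ K%:Z)%Z * K%:Z + p%:Z.
  by rewrite pE gez0_abs ?modz_ge0 // -divz_eq.
have [p0|p0] := posnP p.
  rewrite p0 addr0 in aE; move: m0; rewrite aE => /eqP.
  by rewrite (negPf (mass_vertex_neq0 X _ K0 hxi)).
have p_int : (0 < p < K)%N by rewrite p0 pE.
have := quadrature_phi_interior X (phi_cell X a) K0 hxi aE p_int.
rewrite -/(mass X a a) m0 phi_cell_node // -aE eqxx mulr1 => w0.
rewrite /dlow.
by rewrite (quadrature_phi_interior X (fun i => (phi_cell X b i)^`()) K0 hxi aE p_int)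
  -w0 mul0r.
Qed.

Lemma dupE (R : realType) (K : nat) (xi : 'I_K.+1 -> R) (X : fe_space xi) a b :
  dup X a b = dlow X b a.
Proof. by congr quadrature; apply/funext => i; rewrite mulrC. Qed.

Lemma quadrature_eq0 (R : realType) (K : nat) (xi : 'I_K.+1 -> R)
    (X : fe_space xi) (f : int -> {poly R}) :
  (forall i, f i = 0) -> quadrature X f = 0.
Proof.
move=> f0; apply: fsbig1 => i _; apply: big1 => q _.
by rewrite f0 horner0 mulr0.
Qed.

(** phi_K lives on the cells i >= 0 and phi_(-K) on the cells i < 0. *)
Lemma duplow_far (R : realType) (K : nat) (xi : 'I_K.+1 -> R)
    (X : fe_space xi) : (0 < K)%N -> gauss_lobatto_points xi ->
  duplow X (- K%:Z) K%:Z = 0.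
Proof.
move=> K0 hxi; apply: quadrature_eq0 => i.
have [i0|i0] := ltP i 0.
  rewrite (@phi_cell_support _ _ _ _ K%:Z) // ?deriv0 ?mulr0 //.
  by apply/negP; nia.
rewrite (@phi_cell_support _ _ _ _ (- K%:Z)) // ?deriv0 ?mul0r //.
by apply/negP; nia.
Qed.

Lemma dlow_far_left (R : realType) (K : nat) (xi : 'I_K.+1 -> R)
    (X : fe_space xi) (c : int) : (0 < K)%N -> gauss_lobatto_points xi ->
  c < 0 -> dlow X c K%:Z = 0.
Proof.
move=> K0 hxi c0; apply: quadrature_eq0 => i.
have [i0|i0] := ltP i 0.
  rewrite (@phi_cell_support _ _ _ _ K%:Z) // ?deriv0 ?mulr0 //.
  by apply/negP; nia.
rewrite (@phi_cell_support _ _ _ _ c) // ?mul0r //.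
by apply/negP; nia.
Qed.

Lemma dlow_far_right (R : realType) (K : nat) (xi : 'I_K.+1 -> R)
    (X : fe_space xi) (c : int) : (0 < K)%N -> gauss_lobatto_points xi ->
  0 < c -> dlow X c (- K%:Z) = 0.
Proof.
move=> K0 hxi c0; apply: quadrature_eq0 => i.
have [i0|i0] := ltP i 0.
  rewrite (@phi_cell_support _ _ _ _ c) // ?mul0r //.
  by apply/negP; nia.
rewrite (@phi_cell_support _ _ _ _ (- K%:Z)) // ?deriv0 ?mulr0 //.
by apply/negP; nia.
Qed.

Lemma dlow_next_neq0 (R : realType) (K : nat) (xi : 'I_K.+1 -> R)
    (X : fe_space xi) : (0 < K)%N -> gauss_lobatto_points xi ->
  dlow X 0 K%:Z != 0.
Proof.
move=> K0 hxi; have [w0 _] := quad_weight_ends K0 hxi.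
have s0 : step X != 0 by rewrite gt_eqF // step_gt0.
rewrite /dlow (@quadrature_phi_vertex _ _ _ _ 0 0) ?mul0r //.
rewrite (@phi_cell_support _ _ _ _ K%:Z (0 - 1)) //; last by apply/negP; nia.
rewrite deriv0 horner0 mulr0 add0r !mulf_neq0 //.
apply: (@phi_cell_deriv_neq0 _ _ _ _ _ _ ord_max) => //=.
by rewrite -val_eqE /= eq_sym -lt0n.
Qed.

Lemma dlow_prev_neq0 (R : realType) (K : nat) (xi : 'I_K.+1 -> R)
    (X : fe_space xi) : (0 < K)%N -> gauss_lobatto_points xi ->
  dlow X 0 (- K%:Z) != 0.
Proof.
move=> K0 hxi; have [w0 wK] := quad_weight_ends K0 hxi.
have s0 : step X != 0 by rewrite gt_eqF // step_gt0.
rewrite /dlow (@quadrature_phi_vertex _ _ _ _ 0 0) ?mul0r //.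
rewrite (@phi_cell_support _ _ _ _ (- K%:Z) 0) //; last by apply/negP; nia.
rewrite deriv0 horner0 mulr0 addr0 !mulf_neq0 ?wK //.
apply: (@phi_cell_deriv_neq0 _ _ _ _ _ _ ord0) => //=.
  by rewrite sub0r mulN1r addr0.
by rewrite -val_eqE /= -lt0n.
Qed.

(** Vertex 0 is the only node lying both in a cell of phi_(-K) and in a cell of
    phi_K. *)
Lemma dup_dlow_far (R : realType) (K : nat) (xi : 'I_K.+1 -> R)
    (X : fe_space xi) (c : int) : (0 < K)%N -> gauss_lobatto_points xi ->
  c != 0 -> dup X (- K%:Z) c * dlow X c K%:Z = 0.
Proof.
move=> K0 hxi; rewrite dupE neq_lt => /orP[c0|c0].
  by rewrite (dlow_far_left X K0 hxi c0) mulr0.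
by rewrite (dlow_far_right X K0 hxi c0) mul0r.
Qed.

Lemma dup_mass_inv_dlow_neq0 (R : realType) (K : nat) (xi : 'I_K.+1 -> R)
    (X : fe_space xi) : (0 < K)%N -> gauss_lobatto_points xi ->
  dup X (- K%:Z) 0 * mass_inv X 0 0 * dlow X 0 K%:Z != 0.
Proof.
move=> K0 hxi; rewrite !mulf_neq0 ?dlow_next_neq0 // ?dupE ?dlow_prev_neq0 //.
rewrite /mass_inv eqxx invr_eq0.
by have := mass_vertex_neq0 X 0 K0 hxi; rewrite mul0r.
Qed.

Lemma zmatrix_mul_far (R : realType) (K : nat) (xi : 'I_K.+1 -> R)
    (X : fe_space xi) : (0 < K)%N -> gauss_lobatto_points xi ->
  zmatrix_mul (zmatrix_mul (dup X) (mass_inv X)) (dlow X) (- K%:Z) K%:Z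
  = dup X (- K%:Z) 0 * mass_inv X 0 0 * dlow X 0 K%:Z.
Proof.
move=> K0 hxi.
(* The mass matrix is diagonal, so its inverse only rescales columns. *)
have dM a c : zmatrix_mul (dup X) (mass_inv X) a c
    = dup X a c * mass_inv X c c.
  apply: fsbig_setT_single => e ec.
  by rewrite /mass_inv (negPf ec) mulr0.
rewrite {1}/zmatrix_mul (@fsbig_setT_single _ _ 0) ?dM // => c c0.
by rewrite dM mulrAC dup_dlow_far // mul0r.
Qed.

(** * SUPG stabilization of a discretely divergence-free field *)

Theorem proposition3p2 (R : realType) (K : nat) (hK : (1 <= K)%N)
    (xi : 'I_K.+1 -> R) (hxi : gauss_lobatto_points xi)
    (X Y : fe_space xi) (alpha : R) (halpha : 0 < alpha) :
  ~ (duplow X =2 zmatrix_mul (zmatrix_mul (dup X) (mass_inv X)) (dlow X))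
  /\
  exists u v : grid_function R,
    (forall a b : int, DIV X Y u v a b = 0) /\
    ~ ((forall a b : int, supg_u X Y alpha u v a b = 0) /\
       (forall a b : int, supg_v X Y alpha u v a b = 0)).
Proof.
split.
  move=> /(_ (- K%:Z) K%:Z); rewrite duplow_far // zmatrix_mul_far // => /esym/eqP.
  by rewrite (negPf (dup_mass_inv_dlow_neq0 X hK hxi)).
(* The discrete stream function is psi = delta_(K,K). *)
pose u : grid_function R := fun a b =>
  if a == K%:Z then mass_inv Y b b * dlow Y b K%:Z else 0.
pose v : grid_function R := fun a b =>
  if b == K%:Z then - (mass_inv X a a * dlow X a K%:Z) else 0.
exists u, v; split => [a b|[s_u0 _]].
  rewrite /DIV.
  have -> : tensor_apply (dlow X) (mass Y) u a b = dlow X a K%:Z * dlow Y b K%:Z.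
    rewrite /tensor_apply (@fsbig_setT_single _ _ (K%:Z, b)) /=.
      by rewrite /u eqxx -mulrA [_ * (_ * dlow _ _ _)]mulrA mass_mass_inv_dlow.
    case=> c d /=; rewrite xpair_eqE negb_and /u => /orP[/negPf ->|db].
      by rewrite mulr0.
    by rewrite (mass_offdiag Y hK hxi (a := b)) 1?eq_sym // mulr0 mul0r.
  have -> : tensor_apply (mass X) (dlow Y) v a b
      = - (dlow X a K%:Z * dlow Y b K%:Z).
    rewrite /tensor_apply (@fsbig_setT_single _ _ (a, K%:Z)) /=.
      rewrite /v eqxx -[X in _ = - (X * _)](mass_mass_inv_dlow X) //; ring.
    case=> c d /=; rewrite xpair_eqE negb_and /v => /orP[ca|/negPf ->].
      by rewrite (mass_offdiag X hK hxi (a := a)) 1?eq_sym // !mul0r.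
    by rewrite mulr0.
  by rewrite subrr.
have := s_u0 (- K%:Z) 0; rewrite /supg_u.
have -> : tensor_apply (duplow X) (mass Y) u (- K%:Z) 0 = 0.
  apply: fsbig1 => -[c d] _ /=; rewrite /u.
  by case: eqP => [->|_]; rewrite ?mulr0 // duplow_far // !mul0r.
have -> : tensor_apply (dup X) (dlow Y) v (- K%:Z) 0
    = - (dup X (- K%:Z) 0 * mass_inv X 0 0 * dlow X 0 K%:Z * dlow Y 0 K%:Z).
  rewrite /tensor_apply (@fsbig_setT_single _ _ (0, K%:Z)) /=.
    by rewrite /v eqxx; ring.
  case=> c d /=; rewrite xpair_eqE negb_and /v.
  case: (d =P K%:Z) => [_|_ _]; last by rewrite mulr0.
  rewrite orbF => c0; transitivity (- (dup X (- K%:Z) c * dlow X c K%:Z)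
    * mass_inv X c c * dlow Y 0 d); first by ring.
  by rewrite dup_dlow_far // oppr0 !mul0r.
rewrite add0r => /eqP; apply/negP.
have h_gt0 : 0 < Num.min (step X) (step Y) by rewrite lt_min !step_gt0.
rewrite mulf_neq0 //; first by rewrite gt_eqF // mulr_gt0.
by rewrite oppr_eq0 mulf_neq0 ?dlow_next_neq0 ?dup_mass_inv_dlow_neq0.
Qed.
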